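(* Let $N\ge 2$ and assume that $f$ satisfies (F1) and (F2) (stated in the context). Let $n\ge 2$, $e_0\in\mathbb{S}^{N-1}$, let $e_1,\dots,e_n\in\mathbb{S}^{N-1}$ satisfy $e_i\cdot e_0>0$ for every $i$ and $e_i\ne e_j$ for $i\ne j$, and let $\tau_1,\dots,\tau_n\in\mathbb{R}$. Let $V_{\boldsymbol e,\boldsymbol\tau}$ be the curved front associated with $\boldsymbol e=(e_1,\dots,e_n)$ and $\boldsymbol\tau=(\tau_1,\dots,\tau_n)$ described in the context. Then $V_{\boldsymbol e,\boldsymbol\tau}$ is a transition front of $u_t-\Delta u=f(u)$ connecting $0$ and $1$, with the sets $$\Gamma_t=\Big\{z\in\mathbb{R}^N:\min_{1\le i\le n}\{z\cdot e_i-c_ft+\tau_i\}=0\Big\},$$ $$\Omega_t^+=\Big\{z\in\mathbb{R}^N:\min_{1\le i\le n}\{z\cdot e_i-c_ft+\tau_i\}<0\Big\},\qquad \Omega_t^-=\Big\{z\in\mathbb{R}^N:\min_{1\le i\le n}\{z\cdot e_i-c_ft+\tau_i\}>0\Big\}.$$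
   Context: Assumptions on $f$. (F1) $f\in C^{1+\vartheta}([-\sigma,1+\sigma],\mathbb{R})$ for some $\vartheta\in(0,1]$ and $\sigma\in(0,1)$; there is $\theta\in(0,1)$ such that $f\equiv 0$ on $[0,\theta]\cup\{1\}$, $f>0$ on $(\theta,1)$, and $f'(1)<0$; moreover $f\equiv0$ on $[-\sigma,0)$. (F2) There exist a constant $c_f>0$ and a decreasing function $U\in C^2(\mathbb{R})$ with $U''+c_fU'+f(U)=0$ and $U'<0$ on $\mathbb{R}$, $U(-\infty)=1$, $U(+\infty)=0$, and $\lim_{s\to+\infty}U'(s)/U(s)=-c_f$. Notation. $\underline V(t,z)=\max_{1\le i\le n}U(z\cdot e_i-c_ft+\tau_i)$; $P_i=\{(t,z)\in\mathbb{R}\times\mathbb{R}^N: z\cdot e_i-c_ft+\tau_i=0\}$; $\partial\mathcal P=\{(t,z):\min_{1\le i\le n}\{z\cdot e_i-c_ft+\tau_i\}=0\}$; $\widetilde P_i=P_i\cap\partial\mathcal P$; $\mathcal R=\bigcup_{i\neq j}(\widetilde P_i\cap\widetilde P_j)$; $d$ is Euclidean distance. The curved front $V_{\boldsymbol e,\boldsymbol\tau}$ is the entire (classical, defined on all of $\mathbb{R}\times\mathbb{R}^N$) solution of $u_t-\Delta u=f(u)$ satisfying $\underline V<V_{\boldsymbol e,\boldsymbol\tau}<1$ in $\mathbb{R}\times\mathbb{R}^N$ and, for some $v^\star>0$, $$\frac{|V_{\boldsymbol e,\boldsymbol\tau}(t,z)-\underline V(t,z)|}{\min\{1,\exp(-v^\star\min_{1\le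 i\le n}\frac{z\cdot e_i-c_ft+\tau_i}{e_i\cdot e_0})\}}\to0$$ uniformly as $d((t,z),\mathcal R)\to+\infty$ (i.e. for every $\epsilon>0$ there is $\rho>0$ such that the quotient is $\le\epsilon$ whenever $d((t,z),\mathcal R)\ge\rho$). (Existence of such a solution is known.) Transition front. Let $(\Omega^-_t)_{t\in\mathbb{R}}$, $(\Omega^+_t)_{t\in\mathbb{R}}$ be families of open nonempty subsets of $\mathbb{R}^N$ such that for all $t$: $\Omega_t^+\cap\Omega_t^-=\emptyset$, $\partial\Omega_t^+=\partial\Omega_t^-=:\Gamma_t$, $\Omega_t^+\cup\Omega_t^-\cup\Gamma_t=\mathbb{R}^N$, and $\sup\{d(z,\Gamma_t):z\in\Omega_t^+\}=\sup\{d(z,\Gamma_t):z\in\Omega_t^-\}=+\infty$; and such that, for each sign, $$\inf\{\sup\{d(y,\Gamma_t):y\in\Omega_t^\pm,\ |y-z|\le r\}:t\in\mathbb{R},z\in\Gamma_t\}\to+\infty\quad\text{as }r\to+\infty.$$ Assume also that there is an integer $m\ge1$ such that for each $t$ there are $m$ open sets $\omega_{i,t}\subset\mathbb{R}^{N-1}$, continuous maps $\psi_{i,t}:\omega_{i,t}\to\mathbb{R}$ and rotations $R_{i,t}$ of $\mathbb{R}^N$ $(1\le i\le m)$ with $$\Gamma_t\subset\bigcup_{1\le i\le m}R_{i,t}(\{z\in\mathbb{R}^N:(z_1,\dots,z_{N-1})\in\omega_{i,t},\ z_N=\psi_{i,t}(z_1,\dots,z_{N-1})\}).$$ A transition front connecting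 $0$ and $1$ with such sets is a classical time-global solution $u\not\equiv0,1$ such that for every $\varepsilon>0$ there is $M_\varepsilon>0$ such that for all $t\in\mathbb{R}$: if $z\in\Omega_t^+$ and $d(z,\Gamma_t)\ge M_\varepsilon$ then $u(t,z)\ge1-\varepsilon$; if $z\in\Omega_t^-$ and $d(z,\Gamma_t)\ge M_\varepsilon$ then $u(t,z)\le\varepsilon$. *)

(* Defs.v *)
From HB Require Import structures.
From mathcomp Require Import all_boot all_order all_algebra.
From mathcomp Require Import all_classical all_reals all_analysis.

Set Implicit Arguments.
Unset Strict Implicit.
Unset Printing Implicit Defensive.

Import Order.TTheory GRing.Theory Num.Theory.
Import numFieldNormedType.Exports.

Local Open Scope classical_set_scope.
Local Open Scope ring_scope.

Section FiniteExtrema.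
Variables (R : realType) (n : nat).
Implicit Type F : 'I_n -> R.

(* The neutral element passed to [\big] is the first value of [F], so that for
   [0 < n] these are the minimum and the maximum of the values of [F], as shown
   by the lemmas below (both are [0] when [n = 0]). *)
Definition fmin F : R := \big[Num.min/head 0 (codom F)]_(i < n) F i.
Definition fmax F : R := \big[Num.max/head 0 (codom F)]_(i < n) F i.

Lemma head_codom F : (0 < n)%N -> exists i, head 0 (codom F) = F i.
Proof.
move=> n0; have : head 0 (codom F) \in codom F.
  have : size (codom F) = n by rewrite size_codom card_ord.
  case: (codom F) => [/esym sn|x s _]; first by rewrite sn in n0.
  by rewrite inE eqxx.
by move=> /codomP[i ->]; exists i.
Qed.

Lemma fmin_attained F : (0 < n)%N -> exists i, fmin F = F i.
Proof.
move=> /(head_codom F) h; apply: (big_ind (fun x => exists i, x = F i)) => //.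
  by move=> x y [i ->] [j ->]; case: leP => _; [exists i|exists j].
by move=> i _; exists i.
Qed.

Lemma fmin_le F i : fmin F <= F i.
Proof. exact: bigmin_le_cond. Qed.

Lemma fmax_attained F : (0 < n)%N -> exists i, fmax F = F i.
Proof.
move=> /(head_codom F) h; apply: (big_ind (fun x => exists i, x = F i)) => //.
  by move=> x y [i ->] [j ->]; case: leP => _; [exists j|exists i].
by move=> i _; exists i.
Qed.

Lemma fmax_ge F i : F i <= fmax F.
Proof. exact: le_bigmax_cond. Qed.

End FiniteExtrema.

(* The norm that the library puts on ['rV[R]_N] is the sup norm, which has the
   Euclidean topology but not the Euclidean distance: the latter is defined
   here. *)
Section Euclidean.
Variables (R : realType) (N : nat).
Implicit Types (z y : 'rV[R]_N) (p q : R * 'rV[R]_N).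

Definition dotv z y : R := \sum_(k < N) z 0 k * y 0 k.

Definition enorm z : R := Num.sqrt (dotv z z).

Definition sdist z y : R := enorm (z - y).

Definition stdist p q : R :=
  Num.sqrt ((p.1 - q.1) ^+ 2 + enorm (p.2 - q.2) ^+ 2).

Definition sphere : set 'rV[R]_N := [set z | enorm z = 1].

(* Elements of SO(N), acting on row vectors by [z |-> z *m A]. *)
Definition rotation (A : 'M[R]_N) : Prop := A *m A^T = 1%:M /\ \det A = 1.

(* The graph z_N = psi(z_1, ..., z_{N-1}) over omega, for N >= 1; only the
   values of [psi] on [omega] matter. *)
Definition graph_over (omega : set 'rV[R]_N.-1) (psi : 'rV[R]_N.-1 -> R) :
    set 'rV[R]_N :=
  [set z : 'rV[R]_N | let z' := \row_(k < N.-1) z 0 (widen_ord (leq_pred N) k) in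
     omega z' /\ forall k : 'I_N, k = N.-1 :> nat -> z 0 k = psi z'].

End Euclidean.

(* Distance to a set, with value [+oo] when [A] is empty. *)
Definition dist_to (R : realType) (T : Type) (d : T -> T -> R) (x : T)
    (A : set T) : \bar R :=
  ereal_inf [set (d x y)%:E | y in A].

Definition boundary (T : topologicalType) (A : set T) : set T :=
  closure A `\` A°.

(* f is of class C^{1+vartheta} on [a, b]: derivatives at the end points are
   one-sided, and only the values of [f] on [a, b] matter. *)
Definition C1_hoelder (R : realType) (vartheta a b : R) (f : R -> R) : Prop :=
  exists g : R -> R,
    (forall x, x \in `[a, b] ->
       (f y - f x) / (y - x) @[y --> within `[a, b]%classic x^'] --> g x) /\
    exists C : R, forall x y, x \in `[a, b] -> y \in `[a, b] ->
      `|g x - g y| <= C * `|x - y| `^ vartheta.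

Definition F1 (R : realType) (sigma : R) (f : R -> R) : Prop :=
  [/\ 0 < sigma < 1,
      exists2 vartheta : R, 0 < vartheta <= 1 &
        C1_hoelder vartheta (- sigma) (1 + sigma) f,
      exists2 theta : R, 0 < theta < 1 &
        [/\ forall s, 0 <= s <= theta -> f s = 0,
            f 1 = 0 &
            forall s, theta < s < 1 -> 0 < f s],
      derive1 f 1 < 0 &
      forall s, - sigma <= s < 0 -> f s = 0].

Definition C2 (R : realType) (U : R -> R) : Prop :=
  [/\ forall s, derivable U s 1,
      forall s, derivable (derive1 U) s 1 &
      continuous (derive1n 2 U)].

Definition F2 (R : realType) (f : R -> R) (c : R) (U : R -> R) : Prop :=
  [/\ 0 < c,
      C2 U /\ {homo U : s s' /~ s < s'},
      forall s, derive1n 2 U s + c * derive1 U s + f (U s) = 0 /\ derive1 U s < 0,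
      U s @[s --> -oo_R] --> (1 : R) /\ U s @[s --> +oo_R] --> (0 : R) &
      derive1 U s / U s @[s --> +oo_R] --> - c].

Section Equation.
Variables (R : realType) (N : nat).
Implicit Types (u : R -> 'rV[R]_N -> R).

Definition dt u t z : R := derive1 (u^~ z) t.
Definition dx (i : 'I_N) u t z : R := 'D_('e_i) (u t) z.
Definition laplacian u t z : R := \sum_(i < N) dx i (dx i u) t z.

Definition jointly_continuous u : Prop :=
  continuous (fun p : R * 'rV[R]_N => u p.1 p.2).

(* u is C^1 in t and C^2 in z. *)
Definition C12 u : Prop :=
  [/\ forall t z, derivable (u^~ z) t 1,
      forall i t z, derivable (u t) z 'e_i,
      forall i j t z, derivable (dx i u t) z 'e_j,
      jointly_continuous u /\ jointly_continuous (dt u) &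
      forall i, jointly_continuous (dx i u) /\
        forall j, jointly_continuous (dx j (dx i u))].

(* The nonlinearity is only given on [-sigma, 1 + sigma], so a solution takes
   its values there. *)
Definition entire_solution (sigma : R) (f : R -> R) u : Prop :=
  [/\ forall t z, - sigma <= u t z <= 1 + sigma,
      C12 u &
      forall t z, dt u t z - laplacian u t z = f (u t z)].

End Equation.

Section CurvedFront.
Variables (R : realType) (N n : nat) (c : R).
Variables (e : 'I_n -> 'rV[R]_N) (tau : 'I_n -> R).

Definition phase (i : 'I_n) (t : R) (z : 'rV[R]_N) : R :=
  dotv z (e i) - c * t + tau i.

Definition min_phase (t : R) (z : 'rV[R]_N) : R := fmin (fun i => phase i t z).

Definition Vunder (U : R -> R) (t : R) (z : 'rV[R]_N) : R :=
  fmax (fun i => U (phase i t z)).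

Definition hyperplane (i : 'I_n) : set (R * 'rV[R]_N) :=
  [set p | phase i p.1 p.2 = 0].

Definition polytope_bd : set (R * 'rV[R]_N) :=
  [set p | min_phase p.1 p.2 = 0].

Definition facet (i : 'I_n) : set (R * 'rV[R]_N) :=
  hyperplane i `&` polytope_bd.

Definition ridges : set (R * 'rV[R]_N) :=
  \bigcup_(ij in [set ij : 'I_n * 'I_n | ij.1 != ij.2])
    (facet ij.1 `&` facet ij.2).

Definition curved_front (sigma : R) (f U : R -> R) (e0 : 'rV[R]_N)
    (V : R -> 'rV[R]_N -> R) : Prop :=
  [/\ entire_solution sigma f V,
      forall t z, Vunder U t z < V t z < 1 &
      exists2 vstar : R, 0 < vstar &
        forall eps : R, 0 < eps -> exists2 rho : R, 0 < rho &
          forall t z, (rho%:E <= dist_to (@stdist R N) (t, z) ridges)%E ->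
            `|V t z - Vunder U t z| /
              Num.min 1 (expR (- vstar *
                fmin (fun i => phase i t z / dotv (e i) e0))) <= eps].

End CurvedFront.

Section TransitionFront.
Variables (R : realType) (N : nat).
(* [Om], [Op] and [G] are the families Omega^-, Omega^+ and Gamma; [W] is either
   of the first two. *)
Implicit Types (Om Op W G : R -> set 'rV[R]_N).

Definition sdist_to (z : 'rV[R]_N) (A : set 'rV[R]_N) : \bar R :=
  dist_to (@sdist R N) z A.

Definition uniformly_unbounded W G : Prop :=
  ereal_inf [set ereal_sup [set sdist_to y (G p.1) |
                              y in [set y | W p.1 y /\ sdist y p.2 <= r]]
            | p in [set p : R * 'rV[R]_N | G p.1 p.2]]
    @[r --> +oo_R] --> +oo%E.

Definition finitely_many_graphs G : Prop :=
  exists2 m : nat, (1 <= m)%N &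
    forall t, exists (omega : 'I_m -> set 'rV[R]_N.-1)
                     (psi : 'I_m -> 'rV[R]_N.-1 -> R)
                     (A : 'I_m -> 'M[R]_N),
      (forall i, [/\ open (omega i),
                     {within omega i, continuous (psi i)} &
                     rotation (A i)]) /\
      G t `<=` \bigcup_(i in [set: 'I_m])
                 [set z *m A i | z in graph_over (omega i) (psi i)].

Definition admissible_sets Om Op G : Prop :=
  [/\ forall t, [/\ open (Om t), open (Op t), Om t !=set0 & Op t !=set0],
      forall t, [/\ Op t `&` Om t = set0,
                    boundary (Op t) = G t,
                    boundary (Om t) = G t &
                    Op t `|` Om t `|` G t = setT],
      forall t, ereal_sup [set sdist_to z (G t) | z in Op t] = +oo%E /\
                ereal_sup [set sdist_to z (G t) | z in Om t] = +oo%E,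
      uniformly_unbounded Op G /\ uniformly_unbounded Om G &
      finitely_many_graphs G].

Definition transition_front (sigma : R) (f : R -> R) Om Op G
    (u : R -> 'rV[R]_N -> R) : Prop :=
  [/\ admissible_sets Om Op G,
      entire_solution sigma f u,
      ~ (forall t z, u t z = 0),
      ~ (forall t z, u t z = 1) &
      forall eps : R, 0 < eps -> exists2 M : R, 0 < M & forall t z,
        (Op t z -> (M%:E <= sdist_to z (G t))%E -> 1 - eps <= u t z) /\
        (Om t z -> (M%:E <= sdist_to z (G t))%E -> u t z <= eps)].

End TransitionFront.

(* Main.v *)
Require Import Defs.
From mathcomp Require Import all_boot all_order all_algebra.
From mathcomp Require Import all_classical all_reals all_analysis.
From mathcomp Require Import ring lra.

(* Let m(t,z) be the minimum of the phases and a > 0 the minimum of the e_i.e0.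
   The function m(t,.) is 1-Lipschitz and increases at rate at least a along e0,
   so that |m| <= d(z, Gamma_t) <= |m| / a; translating points of Gamma_t along
   +-e0 yields all the geometric conditions, and Gamma_t is covered by the n
   hyperplanes {z.e_i = c_f t - tau_i}, each a rotated graph of a constant.
   Far from Gamma_t with m < 0, V > U(m) is close to 1. Far from Gamma_t with
   m > 0 the lower bound U(m) is close to 0, and V is close to it because the
   ridges, where m = 0, are at distance at least m / (1 + c_f) from (t,z). *)

Set Implicit Arguments.
Unset Strict Implicit.
Unset Printing Implicit Defensive.

Import Order.TTheory GRing.Theory Num.Theory.
Import numFieldNormedType.Exports.

Local Open Scope classical_set_scope.
Local Open Scope ring_scope.

(** * Minima of finite families *)

Section Extrema.
Variables (R : realType) (n : nat).
Implicit Types F G : 'I_n -> R.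

(** It suffices to evaluate at a minimiser of [G]. The Lipschitz bound and the growth along [e0] of
    the minimum phase reduce to single phases in this way. *)
Lemma fmin_leD F G d : (0 < n)%N -> (forall i, F i <= G i + d) ->
  fmin F <= fmin G + d.
Proof.
move=> n0 FG; have [i ->] := fmin_attained G n0.
exact: le_trans (fmin_le F i) (FG i).
Qed.

Lemma fmin_gt0 F : (0 < n)%N -> (forall i, 0 < F i) -> 0 < fmin F.
Proof. by move=> n0 F0; have [i ->] := fmin_attained F n0. Qed.

End Extrema.

(** * Euclidean scalar product, norm and space-time distance *)

Section Euclidean.
Variables (R : realType) (N : nat).
Implicit Types (x y z v : 'rV[R]_N) (a : R).

Lemma dotvE x y : dotv x y = (x *m y^T) 0 0.
Proof. by rewrite mxE; apply: eq_bigr => k _; rewrite mxE. Qed.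

Lemma dotvC x y : dotv x y = dotv y x.
Proof. by apply: eq_bigr => k _; rewrite mulrC. Qed.

Lemma dotvDl x y z : dotv (x + y) z = dotv x z + dotv y z.
Proof. by rewrite !dotvE mulmxDl mxE. Qed.

Lemma dotvNl x z : dotv (- x) z = - dotv x z.
Proof. by rewrite !dotvE mulNmx mxE. Qed.

Lemma dotvBl x y z : dotv (x - y) z = dotv x z - dotv y z.
Proof. by rewrite dotvDl dotvNl. Qed.

Lemma dotvZl a x z : dotv (a *: x) z = a * dotv x z.
Proof. by rewrite !dotvE -scalemxAl mxE. Qed.

Lemma dotv_ge0 x : 0 <= dotv x x.
Proof. by apply: sumr_ge0 => k _; rewrite -expr2 sqr_ge0. Qed.

Lemma dotv_eq0 x : dotv x x = 0 -> x = 0.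
Proof.
move=> /eqP; rewrite psumr_eq0 => [/allP x0|k _]; last by rewrite -expr2 sqr_ge0.
apply/rowP => k; rewrite mxE; apply/eqP.
by have := x0 k; rewrite mem_index_enum -expr2 sqrf_eq0; exact.
Qed.

Lemma enorm_ge0 x : 0 <= enorm x.
Proof. exact: sqrtr_ge0. Qed.

Lemma enorm_sq x : enorm x ^+ 2 = dotv x x.
Proof. by rewrite sqr_sqrtr ?dotv_ge0. Qed.

Lemma enormN x : enorm (- x) = enorm x.
Proof.
by congr Num.sqrt; apply: eq_bigr => k _; rewrite !mxE mulrNN.
Qed.

Lemma enormZ a x : 0 <= a -> enorm (a *: x) = a * enorm x.
Proof.
move=> a0; rewrite /enorm dotvZl dotvC dotvZl mulrA -expr2 sqrtrM ?sqr_ge0//.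
by rewrite sqrtr_sqr ger0_norm.
Qed.

Lemma sphere_dotv v : sphere v -> dotv v v = 1.
Proof. by move=> v1; rewrite -enorm_sq v1 expr1n. Qed.

(** The component of [x] orthogonal to [v] has squared norm [dotv x x - dotv x v ^+ 2], which is
    nonnegative. *)
Lemma dotv_sphere_le x v : sphere v -> `|dotv x v| <= enorm x.
Proof.
move=> v1; rewrite -(ler_pXn2r (n := 2))// ?nnegrE ?enorm_ge0//.
rewrite real_normK ?num_real// enorm_sq -subr_ge0.
have := dotv_ge0 (x - dotv x v *: v).
rewrite dotvBl ![dotv _ (_ - _)]dotvC !dotvBl !dotvZl.
rewrite ![dotv _ (_ *: _)]dotvC !dotvZl (sphere_dotv v1) (dotvC v x).
by congr (0 <= _); ring.
Qed.

(* Comparison with the sup norm, which defines the topology of ['rV_N]. *)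
Lemma enorm_le_norm x : enorm x <= N%:R * `|x|.
Proof.
rewrite -(ler_pXn2r (n := 2))// ?nnegrE ?enorm_ge0 ?mulr_ge0//.
rewrite enorm_sq (@le_trans _ _ (N%:R * `|x| ^+ 2))//.
  rewrite mulr_natl -[X in _ *+ X]card_ord -sumr_const ler_sum// => k _.
  rewrite -expr2 -real_normK ?num_real// ler_pXn2r ?nnegrE//.
  rewrite [leRHS]/Num.norm /= mx_normrE.
  exact: (le_bigmax (0 : R) (fun ij => `|x ij.1 ij.2|) (0, k)).
rewrite exprMn ler_wpM2r ?sqr_ge0// expr2 -natrM ler_nat.
by case: (N) => // k; rewrite leq_pmulr.
Qed.

Lemma stdist_ge1 (p q : R * 'rV[R]_N) : `|p.1 - q.1| <= stdist p q.
Proof.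
by rewrite -sqrtr_sqr ler_wsqrtr// lerDl sqr_ge0.
Qed.

Lemma stdist_ge2 (p q : R * 'rV[R]_N) : enorm (p.2 - q.2) <= stdist p q.
Proof.
by rewrite -[leLHS]ger0_norm ?enorm_ge0// -sqrtr_sqr ler_wsqrtr// lerDr sqr_ge0.
Qed.

End Euclidean.

(** * Rotations with a prescribed last row *)

Section Rotation.
Variable R : realType.

(** Provides, up to the sign of the determinant, the rotation that turns hyperplanes orthogonal to
    [v] into graphs of constants. *)
Lemma orthogonal_last_row N (v : 'rV[R]_N.+1) : sphere v ->
  exists2 H : 'M[R]_N.+1, H *m H^T = 1%:M & row ord_max H = v.
Proof.
move=> v1; pose u : 'rV[R]_N.+1 := 'e_ord_max; pose w := u - v.
have uu : u *m u^T = 1%:M.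
  by rewrite trmx_delta mul_delta_mx; apply/matrixP => i j; rewrite !mxE !ord1.
have sc (x y : 'rV[R]_N.+1) : x *m y^T = (dotv x y)%:M.
  by rewrite [LHS]mx11_scalar dotvE.
have duu : dotv u u = 1 by rewrite dotvE uu mxE.
have dvv := sphere_dotv v1.
have [w0|w0] := eqVneq (dotv w w) 0.
  exists 1%:M; first by rewrite trmx1 mulmx1.
  by rewrite row1; apply/subr0_eq/dotv_eq0.
(* the Householder reflection exchanging [u] and [v] *)
pose k := 2 / dotv w w; pose H : 'M[R]_N.+1 := 1%:M - k *: (w^T *m w).
have Hsym : H^T = H.
  by rewrite /H linearB /= linearZ /= trmx1 trmx_mul trmxK.
exists H.
  rewrite Hsym /H mulmxBl mul1mx (mulmxBr _ 1%:M) mulmx1 -scalemxAl -scalemxAr.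
  rewrite mulmxA -(mulmxA w^T) sc mul_mx_scalar -scalemxAl !scalerA opprB.
  have -> : k * dotv w w = 2 by rewrite /k divfK.
  by rewrite mulrDr mulr1 scalerDl addrK subrK.
rewrite rowE -/u /H (mulmxBr _ 1%:M) mulmx1 -scalemxAr mulmxA sc mul_scalar_mx scalerA.
(* As [u] and [v] are unit vectors, [dotv w w = 2 - 2 * dotv u v = 2 * dotv u w]; hence the last row
   of [H] is [u - w = v]. *)
have -> : k * dotv u w = 1.
  have : dotv w w = 2 * dotv u w.
    rewrite /w dotvBl ![dotv _ (_ - _)]dotvC !dotvBl duu dvv (dotvC v u); ring.
  rewrite /k => e; rewrite e in w0 *; field.
  by move: w0; rewrite mulf_eq0 negb_or => /andP[].
by rewrite scale1r opprB addrC subrK.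
Qed.

(** If the orthogonal matrix has determinant [-1], negating its first row repairs the sign; as
    [N >= 2], the last row is a different one and stays [v]. *)
Lemma rotation_last_row N (v : 'rV[R]_N) : (2 <= N)%N -> sphere v ->
  exists2 A : 'M[R]_N, rotation A &
    forall k : 'I_N, k = N.-1 :> nat -> row k A = v.
Proof.
case: N v => [//|[//|N]] v _ v1.
have [H HH Hv] := orthogonal_last_row v1.
have lastk (k : 'I_N.+2) : k = N.+1 :> nat -> k = ord_max by move=> k1; apply/val_inj.
have /eqP : \det H ^+ 2 = 1.
  by rewrite expr2 -{2}det_tr -det_mulmx HH det1.
rewrite sqrf_eq1 => /orP[/eqP d1|/eqP d1].
  by exists H => // k /lastk ->.
pose D : 'M[R]_N.+2 := diag_mx (\row_j (if j == 0 then -1 else 1)).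
exists (D *m H).
  split.
    rewrite trmx_mul mulmxA -(mulmxA D H) HH mulmx1 tr_diag_mx mulmx_diag.
    apply/matrixP => i j; rewrite !mxE; case: ifP => _; rewrite ?mulrNN mulr1//.
  rewrite det_mulmx d1 det_diag big_ord_recl big1 ?mxE//= => [|i _].
    by rewrite mulr1 mulrNN mulr1.
  by rewrite mxE.
move=> k /lastk ->; rewrite row_mul row_diag_mx mxE /= scale1r.
by rewrite -Hv rowE.
Qed.

End Rotation.

(** * Boundary of a sublevel set *)

Section Boundary.
Variables (R : realType) (E : normedModType R).

(** Continuity keeps the closure inside [F <= 0]. Conversely, a zero [z] is the limit of
    [z + s *: v] as [s] decreases to [0], and [F < 0] at these points. *)
Lemma boundary_sublevel (F : E -> R) (v : E) : continuous F ->
  (forall z s, 0 < s -> F (z + s *: v) < F z) ->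
  boundary [set z | F z < 0] = [set z | F z = 0].
Proof.
move=> Fc Fv; have oF : open [set z | F z < 0].
  by apply: (@open_comp _ _ F [set x | x < 0]) => [z _|]; [exact: Fc|exact: open_lt].
have cF : closed [set z | F z <= 0].
  by apply: (@preimage_closed _ _ F [set x | x <= 0]) => [z _|]; [exact: Fc|exact: closed_le].
rewrite /boundary (iffLR (interior_id _) oF); apply/seteqP; split => z /=.
  move=> [zc /negP]; rewrite -leNgt => Fz; apply/le_anti; rewrite Fz andbT.
  suff : [set z | F z <= 0] z by [].
  rewrite (iffLR (closure_id _) cF).
  by move: zc; apply: closureS => y /ltW.
move=> Fz; split; last by rewrite Fz ltxx.
have cv : z + s *: v @[s --> 0^'+] --> z.
  apply: cvg_at_right_filter.
  rewrite -[X in _ --> X]addr0 -[X in _ + X](scale0r v).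
  by apply: cvgD; [exact: cvg_cst|apply: cvgZr_tmp; exact: cvg_id].
apply: (closed_cvg (fun y => closure [set z | F z < 0] y)) cv; first exact: closed_closure.
near=> s; apply: subset_closure; rewrite /= -Fz; apply: Fv; near: s.
exact: nbhs_right_gt.
Unshelve. all: by end_near. Qed.

End Boundary.

(** * Criteria for the geometric conditions on the interface *)

Section DistanceToSet.
Variables (R : realType) (N : nat).
Implicit Types (W G : R -> set 'rV[R]_N).

(** A rate [b] independent of [t] and [z] bounds the infimum below by [b * r], which tends to
    infinity. *)
Lemma uniformly_unbounded_linear W G (b : R) : 0 < b ->
  (forall t z r, 0 < r -> G t z -> exists y,
    [/\ W t y, sdist y z <= r & ((b * r)%:E <= sdist_to y (G t))%E]) ->
  uniformly_unbounded W G.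
Proof.
move=> b0 WG; apply/cvgeyPge => A; near=> r.
apply: le_ereal_inf_tmp => _ [[t z] /= Gz <-].
have r0 : 0 < r by near: r; exact: nbhs_pinfty_gt (num_real _).
have [y [Wy yz yG]] := WG t z r r0 Gz.
apply: (@le_trans _ _ (b * r)%:E).
  rewrite lee_fin mulrC -ler_pdivrMr//; near: r; exact: nbhs_pinfty_ge (num_real _).
by apply: le_trans yG _; apply: ereal_sup_ubound; exists y.
Unshelve. all: by end_near. Qed.

(** The last coordinate of [z *m A^T] is the product of [z] with the last row of [A], hence [b] on
    the hyperplane. *)
Lemma hyperplane_graph (v : 'rV[R]_N) (b : R) (A : 'M[R]_N) : rotation A ->
  (forall k : 'I_N, k = N.-1 :> nat -> row k A = v) ->
  [set z | dotv z v = b] `<=` [set z *m A | z in graph_over setT (cst b)].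
Proof.
move=> [AA _] Av z /= zv; exists (z *m A^T); last by rewrite -mulmxA (mulmx1C AA) mulmx1.
split=> // k kN; rewrite -zv -(Av _ kN) mxE.
by apply: eq_bigr => j _; rewrite !mxE.
Qed.

End DistanceToSet.

(** * The minimum phase compared with the distance to the interface *)

Section MinPhase.
Variables (R : realType) (N n : nat) (c : R) (e0 : 'rV[R]_N).
Variables (e : 'I_n -> 'rV[R]_N) (tau : 'I_n -> R).
Hypotheses (n0 : (0 < n)%N) (e01 : sphere e0) (e1 : forall i, sphere (e i)).
Hypothesis ee0 : forall i, 0 < dotv (e i) e0.

Local Notation ph := (phase c e tau).
Local Notation m := (min_phase c e tau).
Local Notation Gamma t := [set z | m t z = 0].

Local Notation a := (fmin (fun i => dotv (e i) e0)).

Let a_gt0 : 0 < a. Proof. exact: fmin_gt0. Qed.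

(** Each phase has the unit vector [e i] as spatial gradient and time derivative [- c]; taking
    minima preserves the resulting bound. *)
Lemma min_phase_lipschitz t s y z :
  `|m t y - m s z| <= enorm (y - z) + `|c| * `|t - s|.
Proof.
have main t' s' y' z' : m t' y' <= m s' z' + (enorm (y' - z') + `|c| * `|t' - s'|).
  apply: fmin_leD => // i; rewrite /phase.
  have := le_trans (ler_norm _) (dotv_sphere_le (y' - z') (e1 i)).
  have := ler_norm (c * (s' - t')); rewrite normrM dotvBl (distrC s'); lra.
have := main t s y z; have := main s t z y.
by rewrite -opprB enormN (distrC s) ler_norml; lra.
Qed.

Lemma min_phase_lipschitz_space t y z : `|m t y - m t z| <= enorm (y - z).
Proof.
by have := min_phase_lipschitz t t y z; rewrite subrr normr0 mulr0 addr0.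
Qed.

Lemma min_phase_continuous t : continuous (m t).
Proof.
move=> z; apply/(@cvgrPdist_le _ _ _ (nbhs z)) => eps eps0.
(* [N.+1] replaces [N] so that the divisor is positive for every [N]. *)
have k0 : 0 < eps / N.+1%:R by rewrite divr_gt0.
near=> y; apply: le_trans (min_phase_lipschitz_space t z y) _.
apply: le_trans (enorm_le_norm _) _.
apply: (@le_trans _ _ (N.+1%:R * `|z - y|)).
  by rewrite ler_wpM2r// ler_nat.
rewrite mulrC -(ler_pdivlMr _ _ (ltr0Sn R N)).
near: y; apply: (@cvgr_dist_le _ _ _ (nbhs z) _ id) k0; exact: cvg_id.
Unshelve. all: by end_near. Qed.

Lemma phase_shift i t z s : ph i t (z + s *: e0) = ph i t z + s * dotv (e i) e0.
Proof. by rewrite /phase dotvDl dotvZl (dotvC e0); ring. Qed.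

(** Each phase grows along [e0] at rate [dotv (e i) e0], which is at least [a]. *)
Lemma min_phase_shift t z s : 0 <= s -> m t z + a * s <= m t (z + s *: e0).
Proof.
move=> s0; rewrite -lerBrDr; apply: fmin_leD => // i.
rewrite phase_shift -addrA lerDl subr_ge0 mulrC ler_wpM2l//.
exact: (fmin_le (fun i => dotv (e i) e0)).
Qed.

Lemma min_phase_shiftN t z s : 0 <= s -> m t (z - s *: e0) <= m t z - a * s.
Proof.
by move=> /(min_phase_shift t (z - s *: e0)); rewrite subrK lerBrDr.
Qed.

(* The minimum of the phases along the line [z + s e0] vanishes exactly at the
   largest of the zeros of the individual phases, all of which increase in [s]. *)
Lemma min_phase_root t z : exists s,
  m t (z + s *: e0) = 0 /\ a * `|s| <= `|m t z|.
Proof.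
have [i si] := fmax_attained (fun i => - ph i t z / dotv (e i) e0) n0.
move: si; set s := fmax _ => si; exists s; split.
  apply/le_anti/andP; split.
    apply: le_trans (fmin_le _ i) _; by rewrite phase_shift si divfK ?gt_eqF// subrr.
  rewrite /min_phase; have [j ->] := fmin_attained (fun i => ph i t (z + s *: e0)) n0.
  rewrite phase_shift -lerBlDl sub0r -ler_pdivrMr//.
  exact: fmax_ge.
(* For [s >= 0], use the index attaining [s]: its phase is at least the minimum. For [s < 0], use
   the index attaining the minimum phase: its own root is at most [s]. *)
have [s0|s0] := leP 0 s.
  rewrite (@le_trans _ _ (dotv (e i) e0 * s))//.
    by rewrite ger0_norm// ler_wpM2r// fmin_le.
  rewrite {1}si mulrC divfK ?gt_eqF//.
  rewrite -normrN (le_trans _ (ler_norm _))// lerN2.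
  exact: (fmin_le (fun i => ph i t z)).
have [j mj] := fmin_attained (fun i => ph i t z) n0.
rewrite (@le_trans _ _ (dotv (e j) e0 * - s))//.
  by rewrite ltr0_norm// ler_wpM2r ?fmin_le// oppr_ge0 ltW.
rewrite mulrN lerNl (@le_trans _ _ (- m t z)) ?lerN2 ?ler_norm//.
rewrite /min_phase mj mulrC -ler_pdivrMr//.
exact: (fmax_ge (fun i => - ph i t z / dotv (e i) e0)).
Qed.

Lemma min_phase_le_dist t z : (`|m t z|%:E <= sdist_to z (Gamma t))%E.
Proof.
apply: le_ereal_inf_tmp => _ [y /= my <-]; rewrite lee_fin.
by have := min_phase_lipschitz_space t z y; rewrite my subr0.
Qed.

(** The root on the line through [z] along [e0] is a point of the interface at distance [|s|] from
    [z], and [a * |s|] is at most [|m t z|]. *)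
Lemma dist_le_min_phase t z M : (M%:E <= sdist_to z (Gamma t))%E -> a * M <= `|m t z|.
Proof.
have [s [ms sz]] := min_phase_root t z => /le_trans dM.
apply: le_trans sz; rewrite ler_pM2l// -lee_fin; apply: dM.
apply: ereal_inf_lbound; exists (z + s *: e0) => //.
rewrite /sdist opprD addrA subrr sub0r enormN.
by rewrite /enorm dotvZl dotvC dotvZl (sphere_dotv e01) mulr1 -expr2 sqrtr_sqr.
Qed.

(** Every ridge point is a zero of the minimum phase, whose Lipschitz constant for the space-time
    distance is at most [1 + c]. *)
Lemma min_phase_le_ridges t z : 0 <= c ->
  ((`|m t z| / (1 + c))%:E <= dist_to (@stdist R N) (t, z) (ridges c e tau))%E.
Proof.
move=> c0; apply: le_ereal_inf_tmp => _ [[s y] [ij _ [[_ /= my] _]] <-].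
rewrite lee_fin ler_pdivrMr ?ltr_wpDr// mulrDr mulr1.
have := min_phase_lipschitz t s z y; rewrite my subr0 (ger0_norm c0) => /le_trans; apply.
rewrite lerD ?(stdist_ge2 (t, z) (s, y))// mulrC ler_wpM2r//.
exact: (stdist_ge1 (t, z) (s, y)).
Qed.

(** * Admissibility of the sets *)

Lemma admissible_min_phase : (2 <= N)%N ->
  admissible_sets (fun t => [set z | 0 < m t z]) (fun t => [set z | m t z < 0])
    (fun t => [set z | m t z = 0]).
Proof.
move=> N2.
(* Starting on the interface, a move of length [r] along [e0] changes the minimum phase by at least
   [a * r], hence reaches that depth. *)
have deep_pos t z r : 0 < r -> m t z = 0 ->
    [/\ 0 < m t (z + r *: e0), sdist (z + r *: e0) z <= r
      & ((a * r)%:E <= sdist_to (z + r *: e0) (Gamma t))%E].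
  move=> r0 mz; have mr := min_phase_shift t z (ltW r0); rewrite mz add0r in mr.
  split; first by apply: lt_le_trans mr; exact: mulr_gt0.
    by rewrite /sdist addrC addKr enormZ ?(ltW r0)// e01 mulr1.
  apply: le_trans (min_phase_le_dist t _).
  by rewrite lee_fin (le_trans mr)// ler_norm.
have deep_neg t z r : 0 < r -> m t z = 0 ->
    [/\ m t (z - r *: e0) < 0, sdist (z - r *: e0) z <= r
      & ((a * r)%:E <= sdist_to (z - r *: e0) (Gamma t))%E].
  move=> r0 mz; have mr := min_phase_shiftN t z (ltW r0); rewrite mz add0r in mr.
  split; first by apply: le_lt_trans mr _; rewrite oppr_lt0 mulr_gt0.
    by rewrite /sdist addrC addKr enormN enormZ ?(ltW r0)// e01 mulr1.
  apply: le_trans (min_phase_le_dist t _).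
  by rewrite lee_fin lerNr in mr *; rewrite (le_trans mr)// -normrN ler_norm.
have Gamma0 t : exists z, m t z = 0.
  by have [s [? _]] := min_phase_root t 0; exists (0 + s *: e0).
have mc := min_phase_continuous.
split.
- move=> t; have [z mz] := Gamma0 t; split.
  + by apply: (@open_comp _ _ (m t) [set x | 0 < x]) => [y _|]; [exact: mc|exact: open_gt].
  + by apply: (@open_comp _ _ (m t) [set x | x < 0]) => [y _|]; [exact: mc|exact: open_lt].
  + by have [? _ _] := deep_pos t z 1 ltr01 mz; exists (z + 1 *: e0).
  + by have [? _ _] := deep_neg t z 1 ltr01 mz; exists (z - 1 *: e0).
- move=> t; split.
  + by apply/seteqP; split => // z [/= m1 m2]; have := lt_trans m1 m2; rewrite ltxx.
  + apply: (boundary_sublevel (v := - e0)) => [|z s s0]; first exact: mc.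
    rewrite scalerN; apply: le_lt_trans (min_phase_shiftN t z (ltW s0)) _.
    by rewrite ltrBlDr ltrDl mulr_gt0.
  (* The positive side is a sublevel set of [- m t], which decreases along [e0]. *)
  + have -> : [set z | 0 < m t z] = [set z | - m t z < 0].
      by apply/seteqP; split => z /=; rewrite oppr_lt0.
    have -> : [set z | m t z = 0] = [set z | - m t z = 0].
      by apply/seteqP; split => z /= => [->|/eqP]; rewrite ?oppr0// oppr_eq0 => /eqP.
    apply: (boundary_sublevel (v := e0)) => [z|z s s0]; first exact: (cvgN (mc t z)).
    rewrite ltrN2; apply: lt_le_trans (min_phase_shift t z (ltW s0)).
    by rewrite ltrDl mulr_gt0.
  + apply/seteqP; split => // z _ /=.
    by have [|?|?] := ltgtP (m t z) 0; [left; left|left; right|right].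
- move=> t; have [z mz] := Gamma0 t.
  split; apply/eqyP => A A0; have Aa : 0 < A / a by rewrite divr_gt0.
  + have [mr _ d] := deep_neg t z _ Aa mz; rewrite mulrC divfK ?gt_eqF// in d.
    by apply: le_trans d _; apply: ereal_sup_ubound; exists (z - (A / a) *: e0).
  + have [mr _ d] := deep_pos t z _ Aa mz; rewrite mulrC divfK ?gt_eqF// in d.
    by apply: le_trans d _; apply: ereal_sup_ubound; exists (z + (A / a) *: e0).
- split; apply: (uniformly_unbounded_linear a_gt0) => t z r r0 mz.
  + by exists (z - r *: e0); exact: deep_neg.
  + by exists (z + r *: e0); exact: deep_pos.
(* One constant graph per phase: a point of the interface lies on the hyperplane of a phase
   attaining the minimum. *)
- exists n => // t.
  have /choice[A AP] : forall i, exists A : 'M[R]_N, rotation A /\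
      forall k : 'I_N, k = N.-1 :> nat -> row k A = e i.
    by move=> i; have [A ? ?] := rotation_last_row N2 (e1 i); exists A.
  exists (fun=> setT), (fun i => cst (c * t - tau i)), A; split=> [i|z /= mz].
    split; [exact: openT| |exact: (AP i).1].
    exact/continuous_subspaceT/cst_continuous.
  have [i mi] := fmin_attained (fun i => ph i t z) n0.
  exists i => //; have [rA Ar] := AP i.
  apply: (hyperplane_graph (v := e i)) => //=.
  by move: mz; rewrite /min_phase mi /phase; lra.
Qed.

End MinPhase.

(** * Limits of the front away from the interface *)

Lemma decreasing_cvg0_gt0 (R : realType) (U : R -> R) :
  {homo U : s s' /~ s < s'} -> U s @[s --> +oo_R] --> (0 : R) ->
  forall s, 0 < U s.
Proof.
(* [U s] exceeds [U (s + 1)], which bounds the limit [0] from above. *)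
move=> dU U0 s; apply: (@le_lt_trans _ _ (U (s + 1))); last by apply: dU; rewrite ltrDl.
apply: (closed_cvg (fun y => y <= U (s + 1))) U0; first exact: closed_le.
near=> x; apply/ltW/dU; near: x; exact: nbhs_pinfty_gt (num_real _).
Unshelve. all: by end_near. Qed.

Theorem mainTheorem2 (R : realType) (N : nat) (hN : (2 <= N)%N)
  (sigma : R) (f : R -> R) (hF1 : F1 sigma f)
  (cf : R) (U : R -> R) (hF2 : F2 f cf U)
  (n : nat) (hn : (2 <= n)%N)
  (e0 : 'rV[R]_N) (he0 : sphere e0)
  (e : 'I_n -> 'rV[R]_N) (he : forall i, sphere (e i))
  (hee0 : forall i, 0 < dotv (e i) e0)
  (hinj : forall i j, i != j -> e i <> e j)
  (tau : 'I_n -> R)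
  (V : R -> 'rV[R]_N -> R) (hV : curved_front cf e tau sigma f U e0 V) :
  transition_front sigma f
    (fun t => [set z | 0 < min_phase cf e tau t z])
    (fun t => [set z | min_phase cf e tau t z < 0])
    (fun t => [set z | min_phase cf e tau t z = 0])
    V.
Proof.
have n0 : (0 < n)%N by exact: ltnW.
have [c0 [_ dU] _ [U1 U0] _] := hF2.
have [Vsol Vlu [v _ Vv]] := hV.
have Upos := decreasing_cvg0_gt0 dU U0.
have a0 : 0 < fmin (fun i => dotv (e i) e0) by exact: fmin_gt0.
set a := fmin _ in a0.
have V_gt0 t z : 0 < V t z.
  have [i Vi] := fmax_attained (fun i => U (phase cf e tau i t z)) n0.
  by have /andP[Vu _] := Vlu t z; apply: lt_trans Vu; rewrite /Vunder Vi.
split=> //.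
- exact: (admissible_min_phase cf tau n0 he0 he hee0).
- by move=> V0; have := V_gt0 0 0; rewrite V0 ltxx.
- by move=> V1; have /andP[_] := Vlu 0 0; rewrite V1 ltxx.
move=> eps eps0; have eps20 : 0 < eps / 2 by rewrite divr_gt0.
have [rho rho0 Vrho] := Vv _ eps20.
have [K [_ UK]] := cvgr_dist_le _ _ U0 _ eps20.
have [L [_ UL]] := cvgr_dist_le _ _ U1 _ eps0.
(* [|m| >= S] puts the relevant phase below [L] when [m < 0] or above [K] when [m > 0], and keeps
   the ridges at distance at least [rho]. Distance [S / a] from the interface ensures it. *)
pose S := `|K| + `|L| + rho * (1 + cf) + 1.
have rc0 : 0 < rho * (1 + cf) by rewrite mulr_gt0// addr_gt0.
have KS : K < S by have := ler_norm K; have := normr_ge0 L; rewrite /S; lra.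
have LS : - S < L.
  by have := ler_norm (- L); rewrite normrN; have := normr_ge0 K; rewrite /S; lra.
have rhoS : rho * (1 + cf) <= S.
  by have := normr_ge0 L; have := normr_ge0 K; rewrite /S; lra.
have S0 : 0 < S by exact: lt_le_trans rhoS.
exists (S / a); first exact: divr_gt0.
move=> t z; split=> /= mz zd; have := dist_le_min_phase n0 he0 hee0 zd;
  rewrite -/a mulrC divfK ?gt_eqF// => Sm.
  rewrite ltr0_norm// in Sm.
  have [i mi] := fmin_attained (fun i => phase cf e tau i t z) n0.
  have iL : phase cf e tau i t z < L.
    by rewrite -mi; apply: le_lt_trans LS; rewrite lerNr.
  have /andP[/ltW VuV _] := Vlu t z; apply: le_trans VuV.
  apply: le_trans (fmax_ge (fun i => U (phase cf e tau i t z)) i).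
  by have := le_trans (ler_norm _) (UL _ iL); lra.
have zr : (rho%:E <= dist_to (@stdist R N) (t, z) (ridges cf e tau))%E.
  apply: le_trans (min_phase_le_ridges tau n0 he t z (ltW c0)).
  by rewrite lee_fin ler_pdivlMr ?addr_gt0// (le_trans rhoS).
rewrite gtr0_norm// in Sm.
have [i Vi] := fmax_attained (fun i => U (phase cf e tau i t z)) n0.
(* Every phase is at least the minimum, in particular the one attaining the maximum of [U]. *)
have iK : K < phase cf e tau i t z.
  apply: lt_le_trans KS (le_trans Sm _).
  exact: (fmin_le (fun i => phase cf e tau i t z)).
have Ui : Vunder cf e tau U t z <= eps / 2.
  rewrite /Vunder Vi; have := UK _ iK; rewrite sub0r normrN; exact: le_trans (ler_norm _).
have := Vrho _ _ zr; set w := Num.min _ _.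
(* The weight is at most [1], so [V] exceeds [Vunder] by at most [eps / 2]. *)
have w0 : 0 < w by rewrite lt_min ltr01 expR_gt0.
have w1 : w <= 1 by rewrite ge_min lexx.
rewrite ler_pdivrMr// => VVu.
have : eps / 2 * w <= eps / 2 by rewrite ler_piMr// ltW.
by have := le_trans (ler_norm _) VVu; lra.
Qed.
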